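(* Let $(A,\cdot,\{\,,\,,\,\})$ be a Nambu-Poisson algebra, $(V;\mu,\rho)$ a representation of it, $(\varphi,\psi)$ a Nambu-Poisson $2$-cocycle of $A$ with coefficients in $V$, and let $r:V\to A$ be a $(\varphi,\psi)$-twisted $\mathcal{O}$-operator on $A$ with respect to the representation $(V;\mu,\rho)$. Then $V$ carries an NS-Nambu-Poisson algebra structure $(V,\diamond_r,*_r,[\,,\,,\,]_r,[\![\,,\,,\,]\!]_r)$, where $$u\diamond_r v:=\mu(r(u))v,\quad u*_r v:=\varphi(r(u),r(v)),\quad [u,v,w]_r:=\rho(r(u),r(v))w,\quad [\![u,v,w]\!]_r:=\psi(r(u),r(v),r(w)),$$ for $u,v,w\in V$. Moreover, the corresponding subadjacent Nambu-Poisson algebra coincides with $(V,\cdot_r,\{\,,\,,\,\}_r)$, where $$u\cdot_r v=\mu(r(u))v+\mu(r(v))u+\varphi(r(u),r(v)),$$ $$\{u,v,w\}_r=\rho(r(u),r(v))w+\rho(r(v),r(w))u+\rho(r(w),r(u))v+\psi(r(u),r(v),r(w)).$$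
   Context: All vector spaces and (multi)linear maps are over a field $k$ of characteristic $0$. A 3-Lie algebra is a vector space $\mathcal L$ with a skew-symmetric trilinear operation $\{\,,\,,\,\}$ satisfying $\{a,b,\{c,d,e\}\}=\{\{a,b,c\},d,e\}+\{c,\{a,b,d\},e\}+\{c,d,\{a,b,e\}\}$. A Nambu-Poisson algebra $(A,\cdot,\{\,,\,,\,\})$ is a commutative associative algebra $(A,\cdot)$ (not assumed unital) together with a 3-Lie algebra structure $\{\,,\,,\,\}$ on $A$ such that $\{a,b,c\cdot d\}=\{a,b,c\}\cdot d+c\cdot\{a,b,d\}$ for all $a,b,c,d\in A$. A representation of a Nambu-Poisson algebra $(A,\cdot,\{\,,\,,\,\})$ is a triple $(V;\mu,\rho)$ of a vector space $V$, a linear map $\mu:A\to\mathrm{End}(V)$ and a skew-symmetric bilinear map $\rho:A\times A\to\mathrm{End}(V)$ such that for all $a,b,c,d\in A$: $\mu(a\cdot b)=\mu(a)\mu(b)$; $\rho(a,b)\rho(c,d)-\rho(c,d)\rho(a,b)=\rho(\{a,b,c\},d)+\rho(c,\{a,b,d\})$; $\rho(\{a,b,c\},d)=\rho(a,b)\rho(c,d)+\rho(b,c)\rho(a,d)+\rho(c,a)\rho(b,d)$; $\mu(\{a,b,c\})=\rho(a,b)\mu(c)-\mu(c)\rho(a,b)$; $\rho(a,b\cdot c)=\mu(b)\rho(a,c)+\mu(c)\rho(a,b)$. A Nambu-Poisson 2-cocycle of $A$ with coefficients in $(V;\mu,\rho)$ is a pair $(\varphi,\psi)$ where: (1) $\varphi:A\times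 A\to V$ is a Harrison 2-cocycle, i.e. bilinear, symmetric, with $\mu(a)\varphi(b,c)-\varphi(a\cdot b,c)+\varphi(a,b\cdot c)-\mu(c)\varphi(a,b)=0$; (2) $\psi:A\times A\times A\to V$ is a 3-Lie 2-cocycle, i.e. trilinear, skew-symmetric, with $\psi(a,b,\{c,d,e\})+\rho(a,b)\psi(c,d,e)=\psi(\{a,b,c\},d,e)+\psi(c,\{a,b,d\},e)+\psi(c,d,\{a,b,e\})+\rho(d,e)\psi(a,b,c)+\rho(e,c)\psi(a,b,d)+\rho(c,d)\psi(a,b,e)$; (3) $\psi(a,b,c\cdot d)+\rho(a,b)\varphi(c,d)=\varphi(c,\{a,b,d\})+\mu(c)\psi(a,b,d)+\varphi(\{a,b,c\},d)+\mu(d)\psi(a,b,c)$, for all $a,b,c,d,e\in A$. A $(\varphi,\psi)$-twisted $\mathcal O$-operator on $A$ with respect to $(V;\mu,\rho)$ is a linear map $r:V\to A$ such that for all $u,v,w\in V$: $r(u)\cdot r(v)=r\big(\mu(r(u))v+\mu(r(v))u+\varphi(r(u),r(v))\big)$ and $\{r(u),r(v),r(w)\}=r\big(\rho(r(u),r(v))w+\rho(r(v),r(w))u+\rho(r(w),r(u))v+\psi(r(u),r(v),r(w))\big)$. An NS-commutative algebra is $(A,\diamond,* )$ with bilinear operations $\diamond,*$ on $A$, $*$ commutative, such that, with $a\odot b=a\diamond b+b\diamond a+a*b$: $a\diamond(b\diamond c)=(a\odot b)\diamond c$ and $a\diamond(b*c)+a*(b\odot c)=b\diamond(a*c)+b*(a\odot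 c)$. An NS-3-Lie algebra is $(A,[\,,\,,\,],[\![\,,\,,\,]\!])$ with trilinear operations on $A$, $[\,,\,,\,]$ skew-symmetric in the first two arguments and $[\![\,,\,,\,]\!]$ completely skew-symmetric, such that, with $\{\!\!\{a,b,c\}\!\!\}=[a,b,c]+[b,c,a]+[c,a,b]+[\![a,b,c]\!]$: $[a,b,[c,d,e]]=[\{\!\!\{a,b,c\}\!\!\},d,e]+[c,\{\!\!\{a,b,d\}\!\!\},e]+[c,d,[a,b,e]]$; $[\{\!\!\{a,b,c\}\!\!\},d,e]=[a,b,[c,d,e]]+[b,c,[a,d,e]]+[c,a,[b,d,e]]$; $[\![a,b,\{\!\!\{c,d,e\}\!\!\}]\!]+[a,b,[\![c,d,e]\!]]=[\![\{\!\!\{a,b,c\}\!\!\},d,e]\!]+[\![c,\{\!\!\{a,b,d\}\!\!\},e]\!]+[\![c,d,\{\!\!\{a,b,e\}\!\!\}]\!]+[d,e,[\![a,b,c]\!]]+[e,c,[\![a,b,d]\!]]+[c,d,[\![a,b,e]\!]]$. An NS-Nambu-Poisson algebra is $(A,\diamond,*,[\,,\,,\,],[\![\,,\,,\,]\!])$ such that $(A,\diamond,* )$ is an NS-commutative algebra, $(A,[\,,\,,\,],[\![\,,\,,\,]\!])$ is an NS-3-Lie algebra, and for all $a,b,c,d\in A$: $\{\!\!\{a,b,c\}\!\!\}\diamond d=[a,b,c\diamond d]-c\diamond[a,b,d]$; $[a\odot b,c,d]=a\diamond[b,c,d]+b\diamond[a,c,d]$; $[\![a,b,c\odot d]\!]+[a,b,c*d]=c*\{\!\!\{a,b,d\}\!\!\}+c\diamond[\![a,b,d]\!]+\{\!\!\{a,b,c\}\!\!\}*d+d\diamond[\![a,b,c]\!]$.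 Its subadjacent Nambu-Poisson algebra is $(A,\odot,\{\!\!\{\,,\,,\,\}\!\!\})$. *)

(* Defs.v *)
From mathcomp Require Import all_boot all_algebra.

Set Implicit Arguments.
Unset Strict Implicit.
Unset Printing Implicit Defensive.

Import GRing.Theory.
Local Open Scope ring_scope.

Section MultilinearMaps.
Variable K : fieldType.

Definition is_bilinear (U V W : lmodType K) (f : U -> V -> W) : Prop :=
  (forall v, linear (f^~ v)) /\ (forall u, linear (f u)).

Definition is_trilinear (U V W X : lmodType K) (f : U -> V -> W -> X) : Prop :=
  [/\ forall v w, linear (fun u => f u v w),
      forall u w, linear (fun v => f u v w)
    & forall u v, linear (f u v)].

Definition skew12 (U W X : lmodType K) (f : U -> U -> W -> X) : Prop :=
  forall a b c, f a b c = - f b a c.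

(* The transpositions (1 2) and (2 3) generate all permutations of the
   three arguments. *)
Definition skew3 (U X : lmodType K) (f : U -> U -> U -> X) : Prop :=
  skew12 f /\ (forall a b c, f a b c = - f a c b).

End MultilinearMaps.

Section NambuPoisson.
Variables (K : fieldType) (A : lmodType K).

Record is_3Lie (br : A -> A -> A -> A) : Prop := Is3Lie {
  lie3_trilinear : is_trilinear br;
  lie3_skew : skew3 br;
  lie3_fundamental : forall a b c d e,
    br a b (br c d e) =
      br (br a b c) d e + br c (br a b d) e + br c d (br a b e) }.

Record is_comm_assoc (mul : A -> A -> A) : Prop := IsCommAssoc {
  ca_bilinear : is_bilinear mul;
  ca_comm : commutative mul;
  ca_assoc : associative mul }.

Record is_nambu_poisson (mul : A -> A -> A) (br : A -> A -> A -> A) : Prop :=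
  IsNambuPoisson {
    np_comm_assoc : is_comm_assoc mul;
    np_3Lie : is_3Lie br;
    np_leibniz : forall a b c d,
      br a b (mul c d) = mul (br a b c) d + mul c (br a b d) }.

Variable V : lmodType K.
Variables (mul : A -> A -> A) (br : A -> A -> A -> A).

(* Maps into End(V) are curried: a linear map A -> End(V) is a bilinear map
   A -> V -> V, and a bilinear map A -> A -> End(V) is a trilinear map
   A -> A -> V -> V. *)
Record is_representation (mu : A -> V -> V) (rho : A -> A -> V -> V) : Prop :=
  IsRepresentation {
    rep_mu_bilinear : is_bilinear mu;
    rep_rho_trilinear : is_trilinear rho;
    rep_rho_skew : skew12 rho;
    rep_mu_mul : forall a b v, mu (mul a b) v = mu a (mu b v);
    rep_rho_comm : forall a b c d v,
      rho a b (rho c d v) - rho c d (rho a b v) =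
        rho (br a b c) d v + rho c (br a b d) v;
    rep_rho_br : forall a b c d v,
      rho (br a b c) d v =
        rho a b (rho c d v) + rho b c (rho a d v) + rho c a (rho b d v);
    rep_mu_br : forall a b c v,
      mu (br a b c) v = rho a b (mu c v) - mu c (rho a b v);
    rep_rho_mul : forall a b c v,
      rho a (mul b c) v = mu b (rho a c v) + mu c (rho a b v) }.

Variables (mu : A -> V -> V) (rho : A -> A -> V -> V).

Record is_harrison_2cocycle (phi : A -> A -> V) : Prop := IsHarrison2Cocycle {
  harrison_bilinear : is_bilinear phi;
  harrison_sym : forall a b, phi a b = phi b a;
  harrison_cocycle : forall a b c,
    mu a (phi b c) - phi (mul a b) c + phi a (mul b c) - mu c (phi a b) = 0 }.

Record is_3Lie_2cocycle (psi : A -> A -> A -> V) : Prop := Is3Lie2Cocycle {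
  lie3_cocycle_trilinear : is_trilinear psi;
  lie3_cocycle_skew : skew3 psi;
  lie3_cocycle : forall a b c d e,
    psi a b (br c d e) + rho a b (psi c d e) =
      psi (br a b c) d e + psi c (br a b d) e + psi c d (br a b e)
      + rho d e (psi a b c) + rho e c (psi a b d) + rho c d (psi a b e) }.

Record is_nambu_poisson_2cocycle
    (phi : A -> A -> V) (psi : A -> A -> A -> V) : Prop :=
  IsNambuPoisson2Cocycle {
    npc_harrison : is_harrison_2cocycle phi;
    npc_3Lie : is_3Lie_2cocycle psi;
    npc_compat : forall a b c d,
      psi a b (mul c d) + rho a b (phi c d) =
        phi c (br a b d) + mu c (psi a b d)
        + phi (br a b c) d + mu d (psi a b c) }.

Record is_twisted_O_operator
    (phi : A -> A -> V) (psi : A -> A -> A -> V) (r : V -> A) : Prop :=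
  IsTwistedOOperator {
    twO_linear : linear r;
    twO_mul : forall u v,
      mul (r u) (r v) = r (mu (r u) v + mu (r v) u + phi (r u) (r v));
    twO_br : forall u v w,
      br (r u) (r v) (r w) =
        r (rho (r u) (r v) w + rho (r v) (r w) u + rho (r w) (r u) v
           + psi (r u) (r v) (r w)) }.

End NambuPoisson.

Section NSNambuPoisson.
Variables (K : fieldType) (A : lmodType K).

Definition subadj_mul (dia star : A -> A -> A) (a b : A) : A :=
  dia a b + dia b a + star a b.

Definition subadj_br (br1 br2 : A -> A -> A -> A) (a b c : A) : A :=
  br1 a b c + br1 b c a + br1 c a b + br2 a b c.

Record is_NS_commutative (dia star : A -> A -> A) : Prop := IsNSCommutative {
  nsc_dia_bilinear : is_bilinear dia;
  nsc_star_bilinear : is_bilinear star;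
  nsc_star_comm : commutative star;
  nsc_dia_mul : forall a b c,
    dia a (dia b c) = dia (subadj_mul dia star a b) c;
  nsc_dia_star : forall a b c,
    dia a (star b c) + star a (subadj_mul dia star b c) =
      dia b (star a c) + star b (subadj_mul dia star a c) }.

(* br1 is [a,b,c] and br2 is [[a,b,c]]. *)
Record is_NS_3Lie (br1 br2 : A -> A -> A -> A) : Prop := IsNS3Lie {
  nsl_br1_trilinear : is_trilinear br1;
  nsl_br2_trilinear : is_trilinear br2;
  nsl_br1_skew : skew12 br1;
  nsl_br2_skew : skew3 br2;
  nsl_br1_br1 : forall a b c d e,
    br1 a b (br1 c d e) =
      br1 (subadj_br br1 br2 a b c) d e + br1 c (subadj_br br1 br2 a b d) e
      + br1 c d (br1 a b e);
  nsl_br1_sub : forall a b c d e,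
    br1 (subadj_br br1 br2 a b c) d e =
      br1 a b (br1 c d e) + br1 b c (br1 a d e) + br1 c a (br1 b d e);
  nsl_br2_br2 : forall a b c d e,
    br2 a b (subadj_br br1 br2 c d e) + br1 a b (br2 c d e) =
      br2 (subadj_br br1 br2 a b c) d e + br2 c (subadj_br br1 br2 a b d) e
      + br2 c d (subadj_br br1 br2 a b e)
      + br1 d e (br2 a b c) + br1 e c (br2 a b d) + br1 c d (br2 a b e) }.

Record is_NS_nambu_poisson
    (dia star : A -> A -> A) (br1 br2 : A -> A -> A -> A) : Prop :=
  IsNSNambuPoisson {
    nsnp_comm : is_NS_commutative dia star;
    nsnp_3Lie : is_NS_3Lie br1 br2;
    nsnp_br_dia : forall a b c d,
      dia (subadj_br br1 br2 a b c) d = br1 a b (dia c d) - dia c (br1 a b d);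
    nsnp_mul_br1 : forall a b c d,
      br1 (subadj_mul dia star a b) c d = dia a (br1 b c d) + dia b (br1 a c d);
    nsnp_br2_mul : forall a b c d,
      br2 a b (subadj_mul dia star c d) + br1 a b (star c d) =
        star c (subadj_br br1 br2 a b d) + dia c (br2 a b d)
        + star (subadj_br br1 br2 a b c) d + dia d (br2 a b c) }.

End NSNambuPoisson.

(* Main.v *)
(* The twisted O-operator identities say that r maps the subadjacent operations
   of V to the operations of A, so each NS-axiom on V is a representation or
   cocycle axiom evaluated on the image of r.  The subadjacent algebra of any
   NS-Nambu-Poisson algebra is a Nambu-Poisson algebra: its associativity,
   fundamental identity and Leibniz rule are signed sums of the NS-axioms at
   permuted arguments. *)
Require Import Defs.
From mathcomp Require Import all_boot all_algebra.

Import GRing.Theory.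
Local Open Scope ring_scope.

(* Loops if a summand occurs twice in the right-hand side. *)
Ltac sum_perm :=
  rewrite -?addrA;
  repeat lazymatch goal with
  | |- ?x = ?x => reflexivity
  | |- ?x + _ = _ =>
      rewrite ?[in RHS](addrC _ x) ?[in RHS](addrCA _ x); congr (x + _)
  end.

Lemma linearPD {K : fieldType} {U V : lmodType K} {f : U -> V} :
  linear f -> {morph f : x y / x + y}.
Proof. by move=> lf x y; have := lf 1 x y; rewrite !scale1r. Qed.

Lemma linearPN {K : fieldType} {U V : lmodType K} {f : U -> V} :
  linear f -> {morph f : x / - x}.
Proof.
move=> lf x; apply: (addIr (f x)).
rewrite -(linearPD lf) !addNr; apply: (addIr (f 0)).
by rewrite -(linearPD lf) !add0r.
Qed.

Lemma linear_add {K : fieldType} {U V : lmodType K} {f g : U -> V} :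
  linear f -> linear g -> linear (fun x => f x + g x).
Proof. by move=> lf lg a x y; rewrite lf lg scalerDr addrACA. Qed.

Section Subadjacent.
Variables (K : fieldType) (A : lmodType K).
Variables (dia star : A -> A -> A) (br1 br2 : A -> A -> A -> A).

Lemma subadj_mul_comm_assoc :
  is_NS_commutative dia star -> is_comm_assoc (subadj_mul dia star).
Proof.
case=> [[dl dr]] [sl sr] sC dM dS.
have mC : commutative (subadj_mul dia star).
  by move=> a b; rewrite /subadj_mul sC [dia a b + _]addrC.
split=> //.
  by split=> u; apply: linear_add => //; apply: linear_add.
(* Left multiplications commute because the subadjacent product is commutative. *)
have dC a b c : dia a (dia b c) = dia b (dia a c) by rewrite !dM mC.
(* The last group is one side of [dS], which exchanges the outer argument [c] with [a]; [dC] then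
   matches the iterated [dia] terms. *)
have mE a b c : subadj_mul dia star (subadj_mul dia star a b) c =
    dia a (dia b c) + dia c (dia a b) + dia c (dia b a)
    + (dia c (star a b) + star c (subadj_mul dia star a b)).
  rewrite {1}/subadj_mul -dM (sC _ c) {1}/subadj_mul !(linearPD (dr c)).
  by rewrite !addrA.
move=> a b c; rewrite [LHS]mC !mE (dS c) (mC c b) (sC c b).
by rewrite (dC a b c) (dC c b a) (dC c a b); sum_perm.
Qed.

(** In the fundamental identity, the left side splits by the position of the inner bracket: [ax2]
    treats it in the first two slots of [br1], [ax1] treats [br1] nested in the third slot, and
    [ax3] absorbs the terms containing [br2]. *)
Lemma subadj_br_3Lie : is_NS_3Lie br1 br2 -> is_3Lie (subadj_br br1 br2).
Proof.
case=> [[l1 l2 l3]] [m1 m2 m3] s12 [t12 t23].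
have TE a b c : subadj_br br1 br2 a b c =
  br1 a b c + br1 b c a + br1 c a b + br2 a b c by [].
(* With [T] opaque, [TE] can unfold an outer bracket while inner ones stay folded, as the axioms
   need them. *)
move: (subadj_br br1 br2) TE => T TE ax1 ax2 ax3.
have ax2r a b c d e : br1 b (T c d e) a =
    br1 c d (br1 b e a) + br1 d e (br1 b c a) + br1 e c (br1 b d a).
  by rewrite s12 ax2 !opprD -(linearPN (l3 c d)) -(linearPN (l3 d e))
    -(linearPN (l3 e c)) -!(s12 b).
split.
- split=> u v a x y; rewrite !TE ?l1 ?l2 ?l3 ?m1 ?m2 ?m3 !scalerDr; sum_perm.
- split=> a b c; rewrite !TE !opprD -(s12 a b) -(s12 c a) -(s12 b c).
    by rewrite -t12; sum_perm.
  by rewrite -t23; sum_perm.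
move=> a b c d e; rewrite !(TE _ _ (T _ _ _)) !(TE _ (T _ _ _) _).
rewrite !(TE (T _ _ _)).
rewrite ax2r (ax2 c d e a b) (TE c d e) !(linearPD (l3 a b)).
(* Brings [br1 a b (br2 c d e)] next to the outer [br2] term; once [T c d e] is refolded, their sum
   is the left side of [ax3]. *)
rewrite 2!(addrAC _ (br1 a b (br2 c d e))) -(addrA _ (br1 a b _)).
rewrite [br1 a b _ + br2 a b _]addrC -(TE c d e) ax3.
(* One instance for each cyclic [br1] summand of [T c d e] under [br1 a b]. *)
rewrite (ax1 a b c d e) (ax1 a b d e c) (ax1 a b e c d).
rewrite (TE a b c) (TE a b d) (TE a b e) !(linearPD (l3 _ _)).
sum_perm.
Qed.

Lemma subadj_nambu_poisson :
  is_NS_nambu_poisson dia star br1 br2 ->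
  is_nambu_poisson (subadj_mul dia star) (subadj_br br1 br2).
Proof.
case=> nsc nsl br_dia mul_br br2_mul.
have ca := subadj_mul_comm_assoc nsc; have lie := subadj_br_3Lie nsl.
split=> // a b c d; case: nsc nsl => [[dl dr]] [sl sr] sC _ _.
case=> [[_ _ l3]] _ s12 _ _ _ _.
have TE x y z : subadj_br br1 br2 x y z =
  br1 x y z + br1 y z x + br1 z x y + br2 x y z by [].
move: (subadj_br br1 br2) {lie} TE br_dia br2_mul => T TE br_dia br2_mul.
(* The product can sit in any slot of the bracket: [br_diaE] and [br2_mul] cover the third,
   [mul_brr] the second, [mul_br] the first. *)
have br_diaE x y z w : br1 x y (dia z w) = dia (T x y z) w + dia z (br1 x y w).
  by rewrite br_dia subrK.
have mul_brr x y z w : br1 x (subadj_mul dia star y z) w =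
    dia y (br1 x z w) + dia z (br1 x y w).
  by rewrite s12 mul_br opprD -!(linearPN (dr _)) -!(s12 x).
rewrite (TE a b (subadj_mul _ _ _ _)) mul_brr mul_br.
rewrite {1}/subadj_mul !(linearPD (l3 a b)) !br_diaE.
rewrite 2!(addrAC _ (br1 a b (star c d))) -(addrA _ (br1 a b _)).
rewrite [br1 a b _ + br2 a b _]addrC br2_mul /subadj_mul.
rewrite (TE a b c) (TE a b d) !(linearPD (dr _)).
sum_perm.
Qed.

End Subadjacent.

Theorem theorem5p5 (K : fieldType) (charK0 : [pchar K] =i pred0)
  (A : lmodType K) (mul : A -> A -> A) (br : A -> A -> A -> A)
  (hA : is_nambu_poisson mul br)
  (V : lmodType K) (mu : A -> V -> V) (rho : A -> A -> V -> V)
  (hV : is_representation mul br mu rho)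
  (phi : A -> A -> V) (psi : A -> A -> A -> V)
  (hc : is_nambu_poisson_2cocycle mul br mu rho phi psi)
  (r : V -> A) (hr : is_twisted_O_operator mul br mu rho phi psi r) :
  let dia_r : V -> V -> V := fun u v => mu (r u) v in
  let star_r : V -> V -> V := fun u v => phi (r u) (r v) in
  let br1_r : V -> V -> V -> V := fun u v w => rho (r u) (r v) w in
  let br2_r : V -> V -> V -> V := fun u v w => psi (r u) (r v) (r w) in
  [/\ is_NS_nambu_poisson dia_r star_r br1_r br2_r,
      is_nambu_poisson (subadj_mul dia_r star_r) (subadj_br br1_r br2_r),
      forall u v, subadj_mul dia_r star_r u v =
        mu (r u) v + mu (r v) u + phi (r u) (r v)
    & forall u v w, subadj_br br1_r br2_r u v w =
        rho (r u) (r v) w + rho (r v) (r w) u + rho (r w) (r u) v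
        + psi (r u) (r v) (r w)].
Proof.
move=> dia_r star_r br1_r br2_r.
suff hNS : is_NS_nambu_poisson dia_r star_r br1_r br2_r.
  by split=> //; apply: subadj_nambu_poisson.
case: hr => lr rM rB.
have mE u v : r (subadj_mul dia_r star_r u v) = mul (r u) (r v) by rewrite rM.
have bE u v w : r (subadj_br br1_r br2_r u v w) = br (r u) (r v) (r w).
  by rewrite rB.
have lcomp (f : A -> V) : linear f -> linear (fun u => f (r u)).
  by move=> lf a u v; rewrite lr lf.
case: hV => [[mul1 mul2]] [rho1 rho2 rho3] rho12 mu_mul rho_comm rho_br
  mu_br rho_mul.
case: hc => [[[phi1 phi2] phiC phiD] [[psi1 psi2 psi3] [psi12 psi23] psiD]
  compat].
split.
- split; rewrite /dia_r /star_r.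
  + by split=> u; [apply: lcomp (mul1 u) | apply: mul2].
  + by split=> u; [apply: lcomp (phi1 (r u)) | apply: lcomp (phi2 (r u))].
  + by move=> u v; apply: phiC.
  + by move=> u v w; rewrite mE mu_mul.
  (* With [r w] in the middle, symmetry of [phi] and [mul] makes the Harrison identity the
     difference of two expressions exchanged by swapping [u] and [v]. *)
  move=> u v w; rewrite !mE; have := phiD (r u) (r w) (r v).
  rewrite (phiC (r w)) (phiC (mul _ _) (r v)).
  rewrite (ca_comm (np_comm_assoc hA) (r w)).
  by rewrite (addrAC (mu _ _)) => /subr0_eq <-; rewrite subrK.
- split; rewrite /br1_r /br2_r.
  + by split=> u v; [apply: lcomp (rho1 _ _) | apply: lcomp (rho2 _ _) | ].
  + split=> u v; [apply: lcomp (psi1 (r u) (r v))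
      | apply: lcomp (psi2 (r u) (r v)) | apply: lcomp (psi3 _ _)].
  + by move=> u v w; apply: rho12.
  + by split=> u v w; [apply: psi12 | apply: psi23].
  + by move=> a b c d e; rewrite !bE -rho_comm subrK.
  + by move=> a b c d e; rewrite bE rho_br.
  by move=> a b c d e; rewrite !bE psiD.
- by move=> a b c d; rewrite /dia_r bE mu_br.
(* [rho_mul] has the product in the second slot, so skew-symmetry is applied before and after it,
   and the signs cancel. *)
- move=> a b c d; rewrite /br1_r /dia_r mE rho12 rho_mul opprD.
  by rewrite -!(linearPN (mul2 _)) -!rho12 addrC.
by move=> a b c d; rewrite /br2_r /star_r /dia_r /br1_r !mE !bE compat.
Qed.
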